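(* For a nonnegative integer $n$, let $A(n)=\left[\binom{i+j}{i}\right]_{0\le i,j\le n}$ and $B(n)=\left[(-1)^{i+j}\sum_{m=0}^n\binom{m}{i}\binom{m}{j}\right]_{0\le i,j\le n}$, both $(n+1)\times(n+1)$ matrices. Then $A(n)$ and $B(n)$ are inverse to each other. *)

(* Defs.v *)
From mathcomp Require Import all_boot all_order all_algebra.

Set Implicit Arguments.
Unset Strict Implicit.
Unset Printing Implicit Defensive.

Import GRing.Theory.
Local Open Scope ring_scope.

Definition matA (n : nat) : 'M[int]_n.+1 :=
  \matrix_(i < n.+1, j < n.+1) ('C(i + j, i))%:Z.

Definition matB (n : nat) : 'M[int]_n.+1 :=
  \matrix_(i < n.+1, j < n.+1)
    ((-1) ^+ (i + j) * \sum_(m < n.+1) ('C(m, i))%:Z * ('C(m, j))%:Z).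

(* Main.v *)
(* With P the Pascal matrix ['C(i, k)], Vandermonde's identity gives A = P P^T,
   and signing the entries of P gives a matrix Q with B = Q^T Q.  Expanding
   'X^i = (('X - 1) + 1)^i shows P Q = 1, so B = (P^T)^-1 P^-1 = A^-1. *)
Require Import Defs.
From mathcomp Require Import all_boot all_order all_algebra.

Import GRing.Theory.
Local Open Scope ring_scope.

Definition pascal_mx (n : nat) : 'M[int]_n.+1 :=
  \matrix_(i < n.+1, k < n.+1) ('C(i, k))%:Z.

Definition signed_pascal_mx (n : nat) : 'M[int]_n.+1 :=
  \matrix_(i < n.+1, k < n.+1) ((-1) ^+ (i + k) * ('C(i, k))%:Z).

(** The symmetry C(i, k) = C(i, i - k) makes this a Vandermonde convolution; as [i <= n], the range
    only gains terms with k > i, which vanish. *)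
Lemma Vandermonde_diag (n i j : nat) : (i <= n)%N ->
  (\sum_(k < n.+1) 'C(i, k) * 'C(j, k) = 'C(i + j, i))%N.
Proof.
move=> le_in; rewrite addnC -binomial.Vandermonde.
rewrite (big_ord_widen n.+1 (fun k => 'C(j, k) * 'C(i, i - k))%N) //.
rewrite [RHS]big_mkcond /=; apply: eq_bigr => k _; rewrite ltnS.
case: leqP => [le_ki | lt_ik]; first by rewrite bin_sub // mulnC.
by rewrite (bin_small lt_ik).
Qed.

Lemma matA_pascal (n : nat) : matA n = pascal_mx n *m (pascal_mx n)^T.
Proof.
apply/matrixP=> i j; rewrite !mxE -(@Vandermonde_diag n); last by rewrite -ltnS.
rewrite -natz natr_sum; apply: eq_bigr => k _.
by rewrite !mxE natz PoszM.
Qed.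

Lemma matB_signed_pascal (n : nat) :
  matB n = (signed_pascal_mx n)^T *m signed_pascal_mx n.
Proof.
apply/matrixP=> i j; rewrite !mxE big_distrr; apply: eq_bigr => m _ /=.
(* The signs (-1)^(m+i) and (-1)^(m+j) multiply to (-1)^(i+j), since (-1)^(2m) = 1. *)
by rewrite !mxE mulrACA -exprD addnACA !exprD -expr2 sqrr_sign mul1r.
Qed.

(** Links row [k] of [signed_pascal_mx] to a polynomial, so that a matrix product can be computed
    coefficientwise. *)
Lemma coef_XsubC1_exp (k j : nat) :
  (('X - 1) ^+ k : {poly int})`_j = (-1) ^+ (k + j) * ('C(k, j))%:Z.
Proof.
rewrite addrC exprDn coef_sum.
under eq_bigr => t _.
  rewrite coefMn -polyCN -rmorphXn /= coefCM coefXn; over.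
case: (leqP j k) => [le_jk | lt_kj].
  rewrite (bigD1 (Ordinal (n := k.+1) (m := j) le_jk)) //= big1 => [|t ne_tj].
    rewrite eqxx mulr1 addr0 -mulr_natr natz; congr (_ * _).
    (* The exponents k + j and k - j differ by the even number 2j. *)
    rewrite -{2}(subnK le_jk) -addnA addnn.
    by rewrite exprD -muln2 exprM sqrr_sign mulr1.
  have ne_jt : (j == t) = false.
    by apply: contraNF ne_tj => /eqP jt; apply/eqP/val_inj.
  by rewrite ne_jt mulr0 mul0rn.
rewrite bin_small // mulr0 big1 // => t _.
by rewrite gtn_eqF ?mulr0 ?mul0rn // (leq_ltn_trans _ lt_kj) // -ltnS.
Qed.

Lemma pascal_mxK (n : nat) : pascal_mx n *m signed_pascal_mx n = 1%:M.
Proof.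
apply/matrixP=> i j; rewrite !mxE.
(* Comparing coefficients of X^j turns row [i] of the product into the expansion of X^i in powers of
   X - 1. *)
have -> : (i == j)%:R = ('X^i : {poly int})`_j by rewrite coefXn eq_sym.
rewrite -[X in X ^+ _](subrK (1 : {poly int})) addrC exprDn coef_sum.
rewrite (big_ord_widen n.+1
  (fun k => (1 ^+ (i - k) * ('X - 1) ^+ k *+ 'C(i, k) : {poly int})`_j)) //.
rewrite [RHS]big_mkcond /=; apply: eq_bigr => k _; rewrite !mxE ltnS.
rewrite expr1n mul1r coefMn coef_XsubC1_exp -mulr_natl natz.
by case: leqP => // lt_ik; rewrite (bin_small lt_ik) mul0r.
Qed.

Theorem theorem4p1 (n : nat) :
  matA n *m matB n = 1%:M /\ matB n *m matA n = 1%:M.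
Proof.
have AB : matA n *m matB n = 1%:M.
  (* The inner factor P^T Q^T is (Q P)^T, so the reverse product Q P = 1 is needed; it follows from
     P Q = 1 because the matrices are square. *)
  rewrite matA_pascal matB_signed_pascal mulmxA -(mulmxA (pascal_mx n)).
  by rewrite -trmx_mul (mulmx1C (pascal_mxK n)) trmx1 mulmx1 pascal_mxK.
by split; last exact: mulmx1C.
Qed.
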